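(* Let $\pi$ be a projective plane of prime order $p$. Let $\mathcal{J}_p$ be the set of all multi-indices $\underline{j}=(j_\alpha:\alpha\in\mathbb{F}_p)$ of non-negative integers with $\sum_{\alpha\in\mathbb{F}_p} j_\alpha=p^2+p+1$, and let $f(\underline{X})=\sum_{\underline{j}\in\mathcal{J}_p}a_{\underline{j}}\underline{X}^{\underline{j}}$ be the complete weight enumerator of the $p$-ary code $C_p(\pi)$ (so $a_{\underline{j}}$ is the number of words of type $\underline{j}$ in $C_p(\pi)$). Then, for any partial linear space $\mathcal{X}$ with at most $\log_2 p$ lines, there are rational numbers $\alpha_{\underline{j}}$ ($\underline{j}\in\mathcal{J}_p$), depending only on $\mathcal{X}$ and $p$ (and not on $\pi$), such that $$i(\mathcal{X},\pi)=\sum_{\underline{j}\in\mathcal{J}_p}\alpha_{\underline{j}}\,a_{\underline{j}}.$$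
   Context: An incidence system is a pair $(P,L)$ where $P$ is a set (of points) and $L$ is a set of subsets of $P$ (the lines); a point $x$ and a line $\ell$ are incident if $x\in\ell$. An incidence system $(P',L')$ is a subsystem of $(P,L)$ if $P'\subseteq P$ and every $\ell'\in L'$ can be written as $\ell'=\ell\cap P'$ for some $\ell\in L$. Two incidence systems $(P,L)$ and $(P',L')$ are isomorphic if there are bijections $f:P\to P'$ and $g:L\to L'$ such that $x\in\ell\Leftrightarrow f(x)\in g(\ell)$ for all $x\in P$, $\ell\in L$. For incidence systems $\mathcal{Y}$ and $\mathcal{X}$ with $\mathcal{X}$ finite, $i(\mathcal{Y},\mathcal{X})$ denotes the number of subsystems of $\mathcal{X}$ which are isomorphic to $\mathcal{Y}$. A partial linear space is an incidence system in which each line has at least two points and any two distinct points are together on at most one line. A projective plane is an incidence system such that: each line has at least two points and any two distinct points are together on a unique line; each point is on at least two lines and any two distinct lines have a unique common point; and for any two distinct lines there is a point on neither of them. A finite projective plane has order $n\ge 2$ if each line has exactly $n+1$ points (equivalently each point is on exactly $n+1$ lines); it then has $n^2+n+1$ points and $n^2+n+1$ lines. For a prime $p$ and a finite set $P$, $\mathbb{F}_p^P$ is the $\mathbb{F}_p$-vector space of functions $P\to\mathbb{F}_p$. The type of $w\in\mathbb{F}_p^P$ is the tuple $(a_\alpha:\alpha\in\mathbb{F}_p)$ with $a_\alpha=\#\{x\in P:w(x)=\alpha\}$. For a finite incidence system $\mathcal{X}=(P,L)$, $C_p(\mathcal{X})$ is the subspace of $\mathbb{F}_p^P$ spanned by the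 indicator functions of the lines of $\mathcal{X}$; its elements are called words. For commuting variables $\underline{X}=(X_\alpha:\alpha\in\mathbb{F}_p)$, write $\underline{X}^{\underline{j}}=\prod_\alpha X_\alpha^{j_\alpha}$. The complete weight enumerator of a subspace $C\subseteq\mathbb{F}_p^P$ is the polynomial $\sum_{w\in C}\underline{X}^{\mathrm{type}(w)}$. *)

(* Defs.v *)
From HB Require Import structures.
From mathcomp Require Import all_boot all_order all_algebra.
From mathcomp Require Import boolp classical_sets functions cardinality.
From mathcomp Require Import finmap mpoly.

Set Implicit Arguments.
Unset Strict Implicit.
Unset Printing Implicit Defensive.

Import GRing.Theory.

Local Open Scope classical_set_scope.
Local Open Scope card_scope.

(* Both the points and the lines are relative to an ambient type [T], so that
   a subsystem of a system over [T] is again a system over [T]. *)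
Record incidence_system (T : Type) := IncidenceSystem {
  points : set T;
  lines : set (set T);
  lines_sub : forall l, lines l -> l `<=` points
}.

HB.instance Definition _ (T : Type) := gen_eqMixin (incidence_system T).
HB.instance Definition _ (T : Type) := gen_choiceMixin (incidence_system T).

Definition subsystem (T : Type) (Y X : incidence_system T) : Prop :=
  points Y `<=` points X /\
  forall l', lines Y l' -> exists2 l, lines X l & l' = l `&` points Y.

Definition isomorphic (T U : Type)
    (X : incidence_system T) (Y : incidence_system U) : Prop :=
  exists (f : points X -> points Y) (g : lines X -> lines Y),
    [/\ bijective f, bijective g &
        forall (x : points X) (l : lines X),
          \val l (\val x) <-> \val (g l) (\val (f x))].

(* As [T] is finite, there are only finitely many incidence systems over [T];
   hence [fset_set] does not take its default value. *)
Definition num_subsystems (U : Type) (T : finType)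
    (Y : incidence_system U) (X : incidence_system T) : nat :=
  #|` fset_set [set S : incidence_system T | subsystem S X /\ isomorphic Y S]|.

Definition partial_linear_space (T : Type) (X : incidence_system T) : Prop :=
  (forall l, lines X l -> exists x y, [/\ l x, l y & x <> y]) /\
  (forall x y l m, points X x -> points X y -> x <> y ->
     lines X l -> lines X m -> l x -> l y -> m x -> m y -> l = m).

(* The empty system satisfies the three usual axioms vacuously, hence the
   nonemptiness clause. *)
Definition projective_plane (T : Type) (X : incidence_system T) : Prop :=
  [/\ points X !=set0,
      (forall l, lines X l -> exists x y, [/\ l x, l y & x <> y]) /\
      (forall x y, points X x -> points X y -> x <> y ->
         exists! l, [/\ lines X l, l x & l y]),
      (forall x, points X x ->
         exists l m, [/\ lines X l, lines X m, l x, m x & l <> m]) /\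
      (forall l m, lines X l -> lines X m -> l <> m ->
         exists! x, [/\ points X x, l x & m x]) &
      forall l m, lines X l -> lines X m -> l <> m ->
        exists x, [/\ points X x, ~ l x & ~ m x]].

Definition has_order (T : Type) (X : incidence_system T) (n : nat) : Prop :=
  (2 <= n)%N /\ forall l, lines X l -> l #= `I_n.+1.

Local Open Scope ring_scope.

Definition line_indicator (p : nat) (T : finType) (X : incidence_system T)
    (l : set T) : {ffun points X -> ('F_p)^o} :=
  [ffun x => (\val x \in l)%:R].

(* [B] ranges over the finite type [{set T}], and [[set` B]] is the
   corresponding classical set. *)
Definition code (p : nat) (T : finType) (X : incidence_system T) :
    {vspace {ffun points X -> ('F_p)^o}} :=
  <<[seq line_indicator p X [set` B]
      | B : {set T} in [pred B : {set T} | `[< lines X [set` B] >] ] ]>>%VS.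

(* The variables indexed by F_p are numbered by the enumeration of F_p. *)
Definition word_type (p : nat) (P : finType) (w : {ffun P -> 'F_p}) :
    'X_{1..#|'F_p|} :=
  [multinom #|[pred x | w x == enum_val i]| | i < #|'F_p|].

Definition complete_weight_enumerator (p : nat) (P : finType)
    (C : {vspace {ffun P -> ('F_p)^o}}) : {mpoly rat[#|'F_p|]} :=
  \sum_(w : {ffun P -> 'F_p} | w \in C) 'X_[word_type w].

(* Main.v *)
Require Import Defs.
From mathcomp Require Import all_boot all_order all_algebra.
From mathcomp Require Import boolp classical_sets functions cardinality.
From mathcomp Require Import finmap mpoly.
From mathcomp Require Import zify fingroup perm.
(* Imported again so that [cover], [subsetP], etc. refer to finite sets. *)
From mathcomp Require Import fintype finset.

(* Lift a word [w] to the weight [W] with values in [0, p). If [w] is in the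
   code then all lines have the same weight modulo [p]; if moreover [W] has
   total weight [s * (p + 1)] with [s < p], then each line [l] has weight
   [s + p * e l] for some natural number [e l], and summing over the pencil of
   a point shows that [W] is the sum of the lines with multiplicities [e], of
   total [s]. Let [k] be the number of lines of [X] and [s = 2 ^ k - 1]. As
   [2 ^ k <= p], crude counting shows that the type of [w] detects whether the
   multiplicities are exactly [1, 2, ..., 2 ^ (k - 1)], each used once. The
   binary digits of such a word [w] then tell which of the [k] distinct lines
   pass through each point, so that the type of [w] determines this
   configuration of lines up to isomorphism, and hence the number of its
   traces on point sets that are isomorphic to [X]. Each copy of [X] in the
   plane arises in this way from the [k!] orderings of its lines. *)

Set Implicit Arguments.
Unset Strict Implicit.
Unset Printing Implicit Defensive.

Import GRing.Theory.

Local Open Scope ring_scope.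

Lemma leq_card_bigcup (I P : finType) (A : {pred I}) (F : I -> {set P}) :
  (#|\bigcup_(i in A) F i| <= \sum_(i in A) #|F i|)%N.
Proof.
elim/big_ind2: _ => [|m B n C Bm Cn|//]; first by rewrite cards0.
by rewrite (leq_trans (leq_card_setU B C)) ?leq_add.
Qed.

(** * Lines of a finite plane *)
Section Plane.
Local Open Scope nat_scope.

(** The points fill the whole type [P], and unique existence is stated as a cardinality, ready for
    double counting. *)
Record fin_plane (p : nat) (P : finType) (L : {set {set P}}) : Prop :=
  FinPlane {
  fp_card_line : forall l, l \in L -> #|l| = p.+1;
  fp_meet : forall l m, l \in L -> m \in L -> l != m -> #|l :&: m| = 1;
  fp_join : forall x y : P, x != y ->
    #|[set l in L | (x \in l) && (y \in l)]| = 1;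
  fp_card_pencil : forall x, #|[set l in L | x \in l]| = p.+1
}.

Variables (p : nat) (P : finType) (L : {set {set P}}).
Hypothesis pl : fin_plane p L.

Lemma double_count (W : P -> nat) (e : {set P} -> nat) :
  \sum_(l in L) e l * (\sum_(x in l) W x) =
  \sum_x W x * (\sum_(l in L | x \in l) e l).
Proof.
under eq_bigr => l _ do rewrite big_distrr /=.
rewrite (exchange_big_dep predT) //=; apply: eq_bigr => x _.
by rewrite big_distrr /=; apply: eq_bigr => l _; rewrite mulnC.
Qed.

(** The lines through [x] cover [x] itself [p + 1] times and every other point exactly once. *)
Lemma sum_pencil (W : P -> nat) x :
  \sum_(l in L | x \in l) \sum_(y in l) W y = p * W x + \sum_y W y.
Proof.
rewrite (exchange_big_dep predT) //= (bigD1 x) //= [\sum_y W y](bigD1 x) //=.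
rewrite sum_nat_const.
have -> : #|[pred i | (i \in L) && (x \in i) & x \in i]| =
          #|[set l in L | x \in l]|.
  by apply: eq_card => l; rewrite !inE unfold_in /=;
    case: (x \in l); rewrite ?andbT ?andbF.
rewrite (fp_card_pencil pl) mulSn addnA [W x + _]addnC; congr (_ + _).
apply: eq_bigr => y yx; rewrite sum_nat_const.
rewrite -[RHS]mul1n -(fp_join pl yx); congr (_ * _).
by apply: eq_card => l; rewrite !inE unfold_in /= -andbA [(x \in l) && _]andbC.
Qed.

(* Every line has weight [s] modulo [p], hence weight [s + p * e l]; summing
   over the pencil of [x] recovers [W x] from [e]. *)
Lemma line_decomposition (W : P -> nat) s : s < p ->
    \sum_x W x = s * p.+1 ->
    (forall l, l \in L -> \sum_(x in l) W x = s %[mod p]) ->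
  exists2 e : {set P} -> nat,
    forall x, W x = \sum_(l in L | x \in l) e l & \sum_(l in L) e l = s.
Proof.
move=> sp sumW lineW; have p0 : 0 < p by apply: leq_ltn_trans sp.
pose e (l : {set P}) := (\sum_(x in l) W x) %/ p.
have eE l : l \in L -> \sum_(x in l) W x = e l * p + s.
  by move=> lL; rewrite {1}(divn_eq (\sum_(x in l) W x) p) lineW // modn_small.
have WE x : W x = \sum_(l in L | x \in l) e l.
  have := sum_pencil W x.
  rewrite (eq_bigr (fun l => e l * p + s)); last by move=> l /andP[/eE].
  rewrite big_split /= -big_distrl /= sum_nat_const sumW.
  have -> : #|[pred i in L | x \in i]| = p.+1.
    by rewrite -(fp_card_pencil pl x); apply: eq_card => l; rewrite !inE.
  rewrite [p.+1 * s]mulnC => /addIn /eqP.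
  by rewrite mulnC eqn_pmul2l // => /eqP.
exists e => //.
(* With unit weights on points, [p + 1] times the sum of [e] is the total weight [s * (p + 1)]. *)
have := double_count (fun=> 1) e.
rewrite (eq_bigr (fun l => e l * p.+1)) => [|l lL]; last first.
  by rewrite sum1_card (fp_card_line pl lL).
rewrite -big_distrl /= (eq_bigr W) => [|x _]; last by rewrite mul1n -WE.
by rewrite sumW => /eqP; rewrite eqn_pmul2r // => /eqP.
Qed.

Lemma card_meet_cover (A : {set {set P}}) l : A \subset L -> l \in L ->
  l \notin A -> #|l :&: cover A| <= #|A|.
Proof.
move=> AL lL lA; rewrite /cover big_distrr /=.
apply: leq_trans (_ : \sum_(m in A) 1 <= _); last by rewrite sum1_card.
apply: leq_trans (leq_card_bigcup _ _) _ => /=.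
apply: leq_sum => m mA; rewrite (fp_meet pl lL (subsetP AL _ mA)) //.
by apply: contraNneq lA => ->.
Qed.

(** Bonferroni bound: adding the lines one by one, each loses at most one point to each earlier
    line. *)
Lemma card_cover_lines (A : {set {set P}}) : A \subset L ->
  #|A| * p.+1 <= #|cover A| + 'C(#|A|, 2).
Proof.
elim: {A}_.+1 {-2}A (ltnSn #|A|) => // n IHn A; rewrite ltnS => An AL.
have [->|[l lA]] := set_0Vmem A; first by rewrite cards0.
have lL := subsetP AL _ lA.
have Al : #|A| = #|A :\ l|.+1 by rewrite (cardsD1 l) lA.
have A'L : A :\ l \subset L by apply: subset_trans (subD1set _ _) AL.
have := IHn (A :\ l) _ A'L; rewrite -ltnS -Al ltnS => /(_ An) IH.
have -> : cover A = l :|: cover (A :\ l) by rewrite /cover (big_setD1 l).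
have := card_meet_cover A'L lL; rewrite !inE eqxx => /(_ isT) lc.
rewrite cardsU (fp_card_line pl lL) Al binS bin1 mulSn.
have : #|l :&: cover (A :\ l)| <= p.+1.
  by rewrite -(fp_card_line pl lL) subset_leq_card ?subsetIl.
by lia.
Qed.

Lemma card_cover_le (A : {set {set P}}) : A \subset L ->
  #|cover A| <= #|A| * p.+1.
Proof.
move=> AL; apply: leq_trans (leq_card_cover A) _.
rewrite -sum_nat_const; apply: leq_sum => l /(subsetP AL) lL.
by rewrite (fp_card_line pl).
Qed.

(** Such a point lies on some [l] in [A] and on another line of [A]; each [l] has at most [#|A| - 1]
    such points. *)
Lemma card_multiple_points (A : {set {set P}}) : A \subset L ->
  #|[set x | 1 < #|[set l in A | x \in l]|]| <= #|A| * #|A|.-1.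
Proof.
move=> AL.
apply: leq_trans (_ : #|\bigcup_(l in A) (l :&: cover (A :\ l))| <= _).
  apply/subset_leq_card/subsetP => x; rewrite inE => /card_gt1P[l [m]].
  rewrite !inE => -[/andP[lA xl] /andP[mA xm] lm].
  apply/bigcupP; exists l => //; rewrite inE xl; apply/bigcupP.
  by exists m => //; rewrite !inE eq_sym lm.
apply: leq_trans (leq_card_bigcup _ _) _; rewrite -sum_nat_const.
apply: leq_sum => l lA; have lL := subsetP AL _ lA.
rewrite [#|A|](cardsD1 l) lA /=; apply: card_meet_cover => //.
  by apply: subset_trans (subD1set _ _) AL.
by rewrite !inE eqxx.
Qed.

End Plane.

(** * Powers of two and binary digits *)

Section Digits.
Local Open Scope nat_scope.

(** When [2 ^ k <= p], this makes [k + 1] lines cover more than [k * (p + 1)] points. *)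
Lemma bin2_le_exp2 k : 'C(k.+1, 2) <= 2 ^ k.
Proof.
elim: k => // k IHk; rewrite binS bin1 expnS mul2n -addnn.
by rewrite leq_add // ltn_expl.
Qed.

(** When [2 ^ k <= p], this puts the bound [k * (k - 1)] on multiple points below [p + 2 - k]. It is
    tight at [k = 3], so small cases are checked separately. *)
Lemma sqr_lt_exp2 k : k * k < 2 ^ k + 2.
Proof.
case: k => [|[|[|[|k]]]] //; rewrite (@leq_ltn_trans (2 ^ k.+4)) ?addn2 //.
elim: k => // k IHk; rewrite expnS; by nia.
Qed.

Lemma sum_exp2 k : \sum_(i < k) 2 ^ i = (2 ^ k).-1.
Proof.
elim: k => [|k IHk]; first by rewrite big_ord0.
by rewrite big_ord_recr /= IHk expnS; have := expn_gt0 2 k; lia.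
Qed.

Lemma sum_digits_lt k (b : 'I_k -> bool) : \sum_(i < k) 2 ^ i * b i < 2 ^ k.
Proof.
rewrite -(prednK (expn_gt0 2 k)) ltnS -sum_exp2.
by apply: leq_sum => i _; case: (b i); rewrite ?muln1 ?muln0.
Qed.

(** Split off the lowest digit: the rest of the sum is even, and halving it shifts the other digits
    down. *)
Lemma odd_sum_digits k (b : 'I_k -> bool) (i : 'I_k) :
  odd ((\sum_(j < k) 2 ^ j * b j) %/ 2 ^ i) = b i.
Proof.
elim: k b i => [|k IHk] b i; first by case: i.
rewrite big_ord_recl /= expn0 mul1n.
have -> : \sum_(j < k) 2 ^ bump 0 j * b (lift ord0 j) =
          (\sum_(j < k) 2 ^ j * b (lift ord0 j)).*2.
  by rewrite -mul2n big_distrr; apply: eq_bigr => j _;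
    rewrite /bump add1n expnS -mulnA.
have [j ->|->] := unliftP ord0 i; last first.
  by rewrite divn1 oddD odd_double oddb addbF.
rewrite /= /bump add1n expnS divnMA divn2 half_bit_double.
exact: IHk (fun j => b (lift ord0 j)) j.
Qed.

End Digits.

(** * Sums of lines with multiplicities 1, 2, 4, ... *)
Section Recognition.
Local Open Scope nat_scope.

Variables (p : nat) (P : finType) (L : {set {set P}}).
Hypothesis pl : fin_plane p L.

Definition is_line_tuple k (l : {ffun 'I_k -> {set P}}) :=
  injectiveb l && [forall i, l i \in L].

Lemma is_line_tupleP k (l : {ffun 'I_k -> {set P}}) :
  reflect (injective l /\ forall i, l i \in L) (is_line_tuple l).
Proof.
apply: (iffP andP) => [[/injectiveP ? /forallP ?]|[? ?]]; split => //.
  exact/injectiveP.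
exact/forallP.
Qed.

(* Conditions on a weight [W] that depend only on how many points have each
   value; by [line_tuple_profile] and [profile_line_tuple] they single out
   the sums [\sum_i 2 ^ i * l_i] over [k] distinct lines [l_i]. *)
Definition profile k (W : P -> nat) :=
  [&& \sum_x W x == (2 ^ k).-1 * p.+1,
      #|[set x | 0 < W x]| <= k * p.+1 &
      [forall i : 'I_k, p.+2 <= #|[set x | W x == 2 ^ i]| + k]].

(** The support lies in a union of [k] lines. A point of [l i] on no other line of the tuple has
    weight [2 ^ i], and at most [k - 1] of the [p + 1] points of [l i] are lost to the other
    lines. *)
Lemma line_tuple_profile k (l : {ffun 'I_k -> {set P}}) : is_line_tuple l ->
  profile k (fun x => \sum_(i < k) 2 ^ i * (x \in l i)).
Proof.
move=> /is_line_tupleP[injl lL].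
have IL : [set l i | i : 'I_k] \subset L.
  by apply/subsetP => _ /imsetP[i _ ->].
have cI : #|[set l i | i : 'I_k]| = k by rewrite card_imset // card_ord.
apply/and3P; split.
- rewrite exchange_big /= -sum_exp2 big_distrl; apply/eqP/eq_bigr => i _ /=.
  by rewrite -big_distrr -big_mkcond /= sum1_card (fp_card_line pl).
- have := card_cover_le pl IL; rewrite cI; apply: leq_trans.
  apply/subset_leq_card/subsetP => x; rewrite inE lt0n sum_nat_eq0.
  case/forallPn => i; rewrite /= muln_eq0 negb_or eqb0 negbK => /andP[_ xi].
  by apply/bigcupP; exists (l i) => //; apply: imset_f.
apply/forallP => i /=; set A := [set l i | i : 'I_k] in IL cI.
have iA : l i \in A by apply: imset_f.
have AiL : A :\ l i \subset L by apply: subset_trans (subD1set _ _) IL.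
have := card_meet_cover pl AiL (lL i); rewrite !inE eqxx => /(_ isT).
have := cardsD1 (l i) A; rewrite iA cI => kE.
have := cardsID (cover (A :\ l i)) (l i).
rewrite (fp_card_line pl (lL i)) => lE.
suff : #|l i :\: cover (A :\ l i)| <=
       #|[set x | \sum_(i < k) 2 ^ i * (x \in l i) == 2 ^ i]|.
  by move=> ? ?; rewrite -lE [X in _ <= _ + X]kE add1n addnS ltnS addnC leq_add.
apply/subset_leq_card/subsetP => x; rewrite !inE => /andP[xNc xi].
rewrite (bigD1 i) //= xi muln1 big1 ?addn0 // => j ji.
case: (boolP (x \in l j)) => [xj|_]; last by rewrite muln0.
case/negP: xNc; apply/bigcupP; exists (l j) => //.
by rewrite !inE imset_f // inj_eq // ji.
Qed.

(** The total weight yields line multiplicities [e] of sum [2 ^ k - 1], the support bound leaves at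
    most [k] lines, and the value counts force each [2 ^ i] to occur among the multiplicities. *)
Lemma profile_line_tuple k (W : P -> nat) : 2 ^ k <= p ->
    (forall l, l \in L -> \sum_(x in l) W x = \sum_x W x %[mod p]) ->
    profile k W ->
  exists2 l : {ffun 'I_k -> {set P}}, is_line_tuple l &
    forall x, W x = \sum_(i < k) 2 ^ i * (x \in l i).
Proof.
move=> kp lineW /and3P[/eqP sumW suppW /forallP valW].
have exp_gt0 := expn_gt0 2 k.
have [|l lL|e We sume] := line_decomposition pl _ sumW; first by lia.
  by rewrite lineW // sumW mulnS addnC modnMDl.
pose A := [set l in L | 0 < e l].
have AL : A \subset L by apply/subsetP => l; rewrite inE => /andP[].
have WA x : W x = \sum_(l in [set l in A | x \in l]) e l.
  rewrite We (bigID (fun l => e l == 0)) /= big1 ?add0n => [|l /andP[_ /eqP]//].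
  by apply: eq_bigl => l; rewrite !inE lt0n -!andbA [(x \in l) && _]andbC.
(* Otherwise [k + 1] lines of [A] would cover at least [(k + 1) * (p + 1) - 'C(k + 1, 2)] points,
   more than the support has. *)
have cA : #|A| <= k.
  rewrite leqNgt; apply/negP => /card_geqP[s [us ss sA]].
  pose B := [set l in s].
  have cB : #|B| = k.+1 by rewrite cardsE (card_uniqP us).
  have BL : B \subset L.
    by apply/subsetP => l; rewrite inE => /sA; apply: (subsetP AL).
  have := card_cover_lines pl BL; rewrite cB.
  have : #|cover B| <= k * p.+1.
    apply: leq_trans suppW; apply/subset_leq_card/subsetP => x /bigcupP[l].
    rewrite !inE WA => /sA lA xl.
    rewrite (bigD1 l) ?inE ?xl ?andbT //=; first by move: lA; rewrite inE; lia.
    by move: lA; rewrite inE.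
  by have := bin2_le_exp2 k; lia.
(* A point of weight [2 ^ i] on a single line of [A] exhibits that line. If there were none, all
   points of this weight would be multiple points of [A], which are too few. *)
have exA (i : 'I_k) : exists l, (l \in A) && (e l == 2 ^ i).
  case: (boolP [exists l, (l \in A) && (e l == 2 ^ i)]) => [/existsP//|].
  move=> /existsPn noA; exfalso.
  have := card_multiple_points pl AL; have := valW i.
  have : #|[set x | W x == 2 ^ i]| <=
         #|[set x | 1 < #|[set l in A | x \in l]|]|.
    apply/subset_leq_card/subsetP => x; rewrite !inE WA ltnNge => /eqP Wx.
    apply/negP => /card_le1_eqP c1.
    have [|[l lAx]] := set_0Vmem [set l in A | x \in l].
      by move=> A0; move: Wx; rewrite A0 big_set0; have := expn_gt0 2 i; lia.
    have /setIdP[lA _] := lAx.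
    have Al : [set l in A | x \in l] = [set l].
      by apply/setP => m; rewrite in_set1; apply/idP/eqP => [/c1/(_ lAx)|->].
    by have := noA l; rewrite lA -Wx Al big_set1 eqxx.
  by have := sqr_lt_exp2 k; nia.
have {exA} [f fP] := fin_all_exists exA.
have fL i : f i \in L by have /andP[/(subsetP AL)] := fP i.
have ef i : e (f i) = 2 ^ i by have /andP[_ /eqP] := fP i.
have injf : injective f.
  move=> i j /(congr1 e); rewrite !ef => /eqP.
  by rewrite eqn_exp2l // => /eqP /val_inj.
pose I := [set f i | i : 'I_k].
have IL : L :&: I = I by apply/setIidPr/subsetP => _ /imsetP[i _ ->].
have sumI (F : {set P} -> nat) : \sum_(l in I) F l = \sum_(i < k) F (f i).
  by rewrite big_imset //= => i j _ _; apply: injf.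
(* The lines [f i] already use up the whole sum [2 ^ k - 1] of the multiplicities. *)
have e0 l : l \in L :\: I -> e l = 0.
  have := sume; rewrite (big_setID I) /= IL sumI (eq_bigr _ (fun i _ => ef i)).
  rewrite sum_exp2 -[in RHS](addn0 _.-1) => /addnI /eqP.
  by rewrite sum_nat_eq0 => /forallP /(_ l) /implyP H /H /eqP.
exists [ffun i => f i].
  by apply/is_line_tupleP; split=> [i j|i]; rewrite !ffunE // => /injf.
move=> x; rewrite We big_mkcondr (big_setID I) /= IL sumI [X in _ + X]big1.
  by rewrite addn0; apply: eq_bigr => i _; rewrite ffunE ef; case: (x \in f i);
    rewrite ?muln1 ?muln0.
by move=> l /e0 ->; case: ifP.
Qed.

End Recognition.

(** * Isomorphism of incidence systems *)
Section Isomorphism.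
Local Open Scope classical_set_scope.

Lemma inj_surj_bijective (A B : Type) (f : A -> B) :
  injective f -> (forall y, exists x, f x = y) -> bijective f.
Proof.
move=> injf /choice[g fg]; exists g => // x; exact: injf.
Qed.

Lemma isomorphic_sym (T U : Type) (X : incidence_system T)
  (Y : incidence_system U) : isomorphic X Y -> isomorphic Y X.
Proof.
move=> [f [g [[f' fK f'K] [g' gK g'K] fg]]]; exists f', g'.
split; [by exists f | by exists g | move=> y m].
by rewrite -{1}(g'K m) -{1}(f'K y); apply: iff_sym.
Qed.

Lemma isomorphic_trans (S T U : Type) (X : incidence_system S)
    (Y : incidence_system T) (Z : incidence_system U) :
  isomorphic X Y -> isomorphic Y Z -> isomorphic X Z.
Proof.
move=> [f [g [bf bg fg]]] [f' [g' [bf' bg' fg']]].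
exists (f' \o f), (g' \o g); split; [exact: bij_comp | exact: bij_comp |].
by move=> x l; apply: iff_trans (fg x l) (fg' _ _).
Qed.

Lemma isomorphic_card_lines (T U : Type) (X : incidence_system T)
  (Y : incidence_system U) : isomorphic X Y -> (lines X #= lines Y)%card.
Proof. by move=> [_ [g [_ bg _]]]; apply/card_bijP; exists g. Qed.

(** Needed for copies of [X] in a plane: a trace with two points determines its line. *)
Lemma isomorphic_line_card2 (T U : Type) (X : incidence_system T)
    (Y : incidence_system U) : isomorphic X Y -> partial_linear_space X ->
  forall l, lines Y l -> exists x y, [/\ l x, l y & x <> y].
Proof.
move=> /isomorphic_sym[f [g [bf bg fg]]] [X2 _] l Yl.
pose l' : lines Y := SigSub (mem_set Yl).
have [x [y [lx ly xy]]] := X2 _ (set_valP (g l')).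
have [f' _ f'K] := bf.
pose x' : points X := SigSub (mem_set (lines_sub (set_valP (g l')) lx)).
pose y' : points X := SigSub (mem_set (lines_sub (set_valP (g l')) ly)).
exists (val (f' x')), (val (f' y')); split.
- by apply/(fg _ l'); rewrite f'K.
- by apply/(fg _ l'); rewrite f'K.
- by move=> /val_inj /(can_inj f'K) [].
Qed.

Lemma incidence_system_eq (T : Type) (X Y : incidence_system T) :
  points X = points Y -> lines X = lines Y -> X = Y.
Proof.
case: X Y => [P L LP] [P' L' LP'] /= eP eL; case: P' / eP LP' => LP'.
by case: L' / eL LP' => LP'; congr IncidenceSystem; apply: Prop_irrelevance.
Qed.

Lemma image_set_inj (A B : Type) (phi : A -> B) :
  injective phi -> injective (fun l : set A => phi @` l).
Proof.
move=> injphi l m lm; apply/funext => x.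
by rewrite -(image_inj (A := l) injphi) lm image_inj.
Qed.

Lemma image_system_sub (T U : Type) (phi : T -> U) (X : incidence_system T) l :
  [set phi @` m | m in lines X] l -> l `<=` phi @` points X.
Proof. by move=> [m Xm <-]; apply: image_subset; apply: lines_sub. Qed.

Definition image_system (T U : Type) (phi : T -> U) (X : incidence_system T) :=
  IncidenceSystem (@image_system_sub T U phi X).

Lemma isomorphic_image (T U : Type) (phi : T -> U) (X : incidence_system T) :
  injective phi -> isomorphic X (image_system phi X).
Proof.
move=> injphi.
pose f (x : points X) : points (image_system phi X) :=
  SigSub (mem_set (ex_intro2 _ _ (val x) (set_valP x) erefl)).
pose g (l : lines X) : lines (image_system phi X) :=
  SigSub (mem_set (ex_intro2 _ _ (val l) (set_valP l) erefl)).
exists f, g; split.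
- apply: inj_surj_bijective => [x y [/injphi/val_inj]//|[y yP]].
  have [x Xx xy] := set_mem yP.
  by exists (SigSub (mem_set Xx)); apply: val_inj.
- apply: inj_surj_bijective => [l m [lm]|[l lP]].
    exact/val_inj/(image_set_inj injphi).
  have [m Xm ml] := set_mem lP.
  by exists (SigSub (mem_set Xm)); apply: val_inj.
- move=> x l /=; split=> [lx|[y ly /injphi <-]//]; by exists (val x).
Qed.

Lemma trace_system_sub (P : finType) (Q : {set P}) (M : {set {set P}}) l :
  [set [set` B :&: Q] | B in [set` M]] l -> l `<=` [set` Q].
Proof. by move=> [B _ <-] x /=; rewrite inE => /andP[]. Qed.

(** [M] may consist of whole lines or of their traces on [Q]; [trace_systemI] identifies the two
    readings. *)
Definition trace_system (P : finType) (Q : {set P}) (M : {set {set P}}) :=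
  IncidenceSystem (@trace_system_sub P Q M).

Lemma card_eq_finset (P : finType) (A : {set P}) : ([set` A] #= `I_#|A|)%card.
Proof.
have -> : [set` A] = @enum_val P (mem A) @` [set: 'I_#|A|].
  apply/seteqP; split=> [x xA|_ [i _ <-]]; last exact: enum_valP.
  by exists (enum_rank_in xA x) => //; rewrite enum_rankK_in.
apply: card_eq_trans (inj_card_eq _) _ => [i j _ _|]; first exact: enum_val_inj.
by rewrite card_eq_sym card_II.
Qed.

Lemma card_finset_eq (P : finType) (A : {set P}) n :
  ([set` A] #= `I_n)%card -> #|A| = n.
Proof.
move=> An; apply/card_eq_II.
by rewrite -(card_eqr An) card_eq_sym card_eq_finset.
Qed.

Lemma set_finset_inj (P : finType) : injective (fun A : {set P} => [set` A]).
Proof.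
move=> A B AB; apply/setP => x; apply/idP/idP => xA.
  by have : [set` A] x by []; rewrite AB.
by have : [set` B] x by []; rewrite -AB.
Qed.

End Isomorphism.

(** * Projective planes as finite planes *)

Section ProjectivePlane.
Local Open Scope nat_scope.

Definition point_set (T : finType) (X : incidence_system T) (l : set T) :
  {set points X} := [set x | val x \in l].

Definition line_sets (T : finType) (X : incidence_system T) :
    {set {set points X}} :=
  [set B | `[< exists2 l, lines X l & B = point_set X l >]].

Lemma line_setsP (T : finType) (X : incidence_system T) B :
  reflect (exists2 l, lines X l & B = point_set X l) (B \in line_sets X).
Proof. by rewrite inE; apply: (iffP (asboolP _)). Qed.

Lemma in_point_set (T : finType) (X : incidence_system T) l x :
  x \in point_set X l <-> l (val x).
Proof. by rewrite inE in_setE. Qed.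

Lemma image_point_set (T : finType) (X : incidence_system T) l :
  (l `<=` points X -> val @` [set` point_set X l] = l)%classic.
Proof.
move=> Xl; apply/seteqP; split=> [_ [x /in_point_set lx <-]//|x lx].
exists (SigSub (mem_set (Xl _ lx))) => //; exact/in_point_set.
Qed.

(** Projection from [x] matches the lines through [x] with the points of [m]. *)
Lemma card_pencil_off_line n (P : finType) (L : {set {set P}}) x m :
    (forall l, l \in L -> #|l| = n) ->
    (forall l m, l \in L -> m \in L -> l != m -> #|l :&: m| = 1) ->
    (forall x y : P, x != y ->
       #|[set l in L | (x \in l) && (y \in l)]| = 1) ->
  m \in L -> x \notin m -> #|[set l in L | x \in l]| = n.
Proof.
move=> card_line meet join mL xm.
rewrite -(card_line m mL) -[RHS]sum1_card -sum1_card.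
transitivity (\sum_(l in [set l in L | x \in l]) \sum_(y in m | y \in l) 1).
  apply: eq_bigr => l; rewrite inE => /andP[lL xl].
  rewrite sum1_card -(meet l m) //; last by apply: contraNneq xm => <-.
  by apply: eq_card => y; rewrite !inE andbC.
rewrite (exchange_big_dep (mem m)) /=; last by move=> l y _ /andP[].
apply: eq_bigr => y ym; have xy : x != y by apply: contraNneq xm => ->.
transitivity #|[set l in L | (x \in l) && (y \in l)]|; last exact: join.
rewrite -sum1_card; apply: eq_bigl => l.
by rewrite !inE ym /= andbA.
Qed.

Lemma projective_plane_fin_plane p (T : finType) (X : incidence_system T) :
  projective_plane X -> has_order X p -> fin_plane p (line_sets X).
Proof.
move=> [_ [twoX joinX] [pencilX meetX] offX] [_ ordX].
have card_line l : l \in line_sets X -> #|l| = p.+1.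
  move=> /line_setsP[m Xm ->]; apply: card_finset_eq.
  apply: card_eq_trans (ordX m Xm).
  rewrite -[X in (_ #= X)%card](image_point_set (lines_sub Xm)) card_eq_sym.
  by apply: inj_card_eq => x y _ _; apply: val_inj.
have join x y : x != y ->
    #|[set l in line_sets X | (x \in l) && (y \in l)]| = 1.
  move=> xy; have [l [[Xl lx ly] lU]] :
      exists! l, [/\ lines X l, l (val x) & l (val y)].
    by apply: joinX (set_valP x) (set_valP y) _ => /val_inj/eqP; apply/negP.
  apply/eqP/cards1P; exists (point_set X l); apply/setP => B.
  rewrite in_set1 inE; apply/andP/eqP.
    move=> [/line_setsP[m Xm ->] /andP[/in_point_set mx /in_point_set my]].
    by rewrite -(lU m).
  move=> ->; split; first by apply/line_setsP; exists l.
  by apply/andP; split; apply/in_point_set.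
have meet l m : l \in line_sets X -> m \in line_sets X -> l != m ->
    #|l :&: m| = 1.
  move=> /line_setsP[l' Xl ->] /line_setsP[m' Xm ->] lm.
  have [|x [[Xx lx mx] xU]] := meetX _ _ Xl Xm.
    by move=> E; rewrite E eqxx in lm.
  apply/eqP/cards1P; exists (SigSub (mem_set Xx)); apply/setP => y.
  rewrite in_set1 in_setI; apply/andP/eqP.
    move=> [/in_point_set ly /in_point_set my]; apply: val_inj => /=.
    by rewrite (xU (val y)) //; split => //; apply: set_valP.
  by move=> ->; split; apply/in_point_set.
split=> // x.
(* Take lines [l], [m] through [x], a point [z] off both, and [y] on [l] other than [x]. If the line
   [yz] contained [x] it would equal [l], which misses [z]. *)
have [m mL xm] : exists2 m, m \in line_sets X & x \notin m.
  have [l [m [Xl Xm lx mx lm]]] := pencilX _ (set_valP x).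
  have [z [Xz zl _]] := offX _ _ Xl Xm lm.
  have [y ly yx] : exists2 y, l y & val x <> y.
    have [a [b [la lb ab]]] := twoX l Xl.
    by have [xa|] := pselect (val x = a); [exists b; rewrite ?xa | exists a].
  have Xy := lines_sub Xl ly.
  have [|n [[Xn ny nz] _]] := joinX _ _ Xy Xz.
    by move=> yz; rewrite -yz in zl.
  exists (point_set X n); first by apply/line_setsP; exists n.
  apply/negP => /in_point_set nx; apply: zl.
  have [k [_ kU]] := joinX _ _ (set_valP x) Xy yx.
  by rewrite -(kU l) // (kU n).
exact: card_pencil_off_line card_line meet join mL xm.
Qed.

(** [sum_pencil] with unit weights reads [(p + 1) ^ 2 = p + #|P|]. *)
Lemma card_fin_plane p (P : finType) (L : {set {set P}}) (x : P) :
  fin_plane p L -> #|P| = p ^ 2 + p + 1.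
Proof.
move=> pl; have /= := sum_pencil pl (fun=> 1) x; rewrite [X in _ + X]sum1_card.
rewrite (eq_bigr (fun=> p.+1)) => [|l /andP[lL _]]; last first.
  by rewrite sum1_card (fp_card_line pl).
rewrite sum_nat_const.
have -> : #|[pred l in L | x \in l]| = p.+1.
  by rewrite -(fp_card_pencil pl x); apply: eq_card => l; rewrite !inE.
by rewrite muln1 -mulnn; have -> : #|{: P}| = #|P| by []; lia.
Qed.

End ProjectivePlane.

(** * Words of the code *)
Section Words.

Variables (p : nat) (T : finType) (X : incidence_system T).
Hypotheses (p_prime : prime p) (planeX : projective_plane X)
  (orderX : has_order X p).

Let pl : fin_plane p (line_sets X) := projective_plane_fin_plane planeX orderX.

Lemma line_indicatorE l :
  line_indicator p X l = [ffun x => (x \in point_set X l)%:R].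
Proof. by apply/ffunP => x; rewrite !ffunE inE. Qed.

Lemma code_ind (V : {pred {ffun points X -> ('F_p)^o}}) :
    0 \in V -> {in V &, forall u v, u + v \in V} ->
    (forall a, {in V, forall u, a *: u \in V}) ->
    (forall l, lines X l -> line_indicator p X l \in V) ->
  forall w, w \in code p X -> w \in V.
Proof.
move=> V0 VD VZ Vl w; rewrite /code; set s := image _ _.
move=> /(@coord_span _ _ _ (in_tuple s)) ->.
apply: (big_ind (fun u => u \in V)) => // i _; apply: VZ.
have /imageP[B] : (in_tuple s)`_i \in s by rewrite mem_nth.
by rewrite inE => /asboolP lB ->; apply: Vl.
Qed.

(** The condition is linear, so generators suffice: a line [m] has total [p + 1] and meets [l] in 1
    or [p + 1] points, all equal to 1 in ['F_p]. *)
Lemma code_line_sum (w : {ffun points X -> 'F_p}) l :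
  w \in code p X -> l \in line_sets X -> \sum_(x in l) w x = \sum_x w x.
Proof.
move=> wC lL; pose V := [pred w : {ffun points X -> ('F_p)^o} |
  \sum_(x in l) w x == \sum_x w x].
apply/eqP; suff : w \in V by [].
apply: code_ind wC => [|u v|a u|m Xm]; rewrite !inE.
- by rewrite !big1 // => x _; rewrite ffunE.
- move=> /eqP uV /eqP vV.
  under eq_bigr do rewrite ffunE.
  under [in X in _ == X]eq_bigr do rewrite ffunE.
  by rewrite !big_split /= uV vV.
- move=> /eqP uV.
  under eq_bigr do rewrite ffunE.
  under [in X in _ == X]eq_bigr do rewrite ffunE.
  by rewrite -!scaler_sumr uV.
have mL : point_set X m \in line_sets X by apply/line_setsP; exists m.
rewrite line_indicatorE.
under eq_bigr do rewrite ffunE; under [in X in _ == X]eq_bigr do rewrite ffunE.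
have p1 : p.+1%:R = 1 :> 'F_p by rewrite -natr1 pchar_Fp_0 ?add0r.
rewrite -!natr_sum -!big_mkcondr /= !sum1_card.
have -> : #|[pred x in l | x \in point_set X m]| = #|l :&: point_set X m|.
  by apply: eq_card => x; rewrite !inE.
rewrite (fp_card_line pl mL) p1.
have [->|lm] := eqVneq l (point_set X m); last by rewrite (fp_meet pl).
by rewrite setIid (fp_card_line pl mL) p1.
Qed.

Lemma natr_Fp_lift (a : 'F_p) : (a : nat)%:R = a.
Proof. exact: natr_Zp. Qed.

Definition lift_word (P : finType) (w : {ffun P -> 'F_p}) (x : P) : nat := w x.

Definition tuple_word (P : finType) k (l : {ffun 'I_k -> {set P}}) :
    {ffun P -> 'F_p} :=
  [ffun x => (\sum_(i < k) 2 ^ i * (x \in l i))%N%:R].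

(** The digit sum is below [2 ^ k <= p], so no reduction modulo [p] takes place. *)
Lemma lift_tuple_word (P : finType) k (l : {ffun 'I_k -> {set P}}) x :
  (2 ^ k <= p)%N ->
  lift_word (tuple_word l) x = (\sum_(i < k) 2 ^ i * (x \in l i))%N.
Proof.
move=> kp; rewrite /lift_word ffunE val_Fp_nat // modn_small //.
exact: leq_trans (sum_digits_lt _) kp.
Qed.

Lemma tuple_word_code k (l : {ffun 'I_k -> {set points X}}) :
  is_line_tuple (line_sets X) l -> tuple_word l \in code p X.
Proof.
move=> /is_line_tupleP[_ lL].
have -> : tuple_word l = \sum_(i < k) (2 ^ i)%:R *:
    ([ffun x => (x \in l i)%:R] : {ffun points X -> ('F_p)^o}).
  apply/ffunP => x; rewrite sum_ffunE ffunE natr_sum; apply: eq_bigr => i _.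
  by rewrite !ffunE natrM.
apply: rpred_sum => i _; apply: rpredZ; apply: memv_span.
have /line_setsP[m Xm ->] := lL i; rewrite -line_indicatorE.
(* The generators of [code] are indexed by boolean sets, so [m] is rewritten as one. *)
have mE : m = [set` [set x : T | x \in m]%SET]%classic.
  by apply/seteqP; split=> x; rewrite /= inE in_setE.
by rewrite {1}mE; apply: image_f; rewrite inE; apply/asboolP; rewrite -mE.
Qed.

Lemma code_profile k (w : {ffun points X -> 'F_p}) : (2 ^ k <= p)%N ->
    w \in code p X -> profile p k (lift_word w) ->
  exists2 l : {ffun 'I_k -> {set points X}},
    is_line_tuple (line_sets X) l & w = tuple_word l.
Proof.
move=> kp wC profw.
have [l lL|l lt wl] := profile_line_tuple pl kp _ profw.
  have := code_line_sum wC lL => /(congr1 (fun a : 'F_p => a : nat)).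
  rewrite -[in LHS](eq_bigr _ (fun x _ => natr_Fp_lift (w x))).
  rewrite -[in RHS](eq_bigr _ (fun x _ => natr_Fp_lift (w x))).
  by rewrite -!natr_sum !val_Fp_nat.
exists l => //; apply/ffunP => x; rewrite ffunE -wl.
exact/esym/natr_Fp_lift.
Qed.

End Words.

(** * Copies of a system as traces of line tuples *)
Section Counting.
Local Open Scope nat_scope.

Definition trace_count (U : Type) (X : incidence_system U) (P : finType) k
    (l : 'I_k -> {set P}) : nat :=
  #|[set Q : {set P} |
      `[< isomorphic X (trace_system Q [set l i | i : 'I_k]) >]]|.

(** The subsystems isomorphic to [X], encoded as pairs of finite sets: points, and lines given as
    traces. *)
Definition trace_copies (U : Type) (X : incidence_system U) (P : finType)
    (L : {set {set P}}) : {set {set P} * {set {set P}}} :=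
  [set QM : {set P} * {set {set P}} |
     (QM.2 \subset [set l :&: QM.1 | l in L]) &&
     `[< isomorphic X (trace_system QM.1 QM.2) >] ].

Lemma trace_copiesP (U : Type) (X : incidence_system U) (P : finType)
    (L : {set {set P}}) Q (M : {set {set P}}) :
  reflect ((forall B, B \in M -> exists2 l, l \in L & B = l :&: Q) /\
           isomorphic X (trace_system Q M))
    ((Q, M) \in trace_copies X L).
Proof.
rewrite inE /=; apply: (iffP andP) => [[/subsetP ML /asboolP]|[ML iM]];
  split=> //.
- by move=> B /ML /imsetP.
- by apply/subsetP => B /ML[l lL ->]; apply: imset_f.
- exact/asboolP.
Qed.

Lemma trace_copies_sub (U : Type) (X : incidence_system U) (P : finType)
    (L : {set {set P}}) Q (M : {set {set P}}) B :
  (Q, M) \in trace_copies X L -> B \in M -> B :&: Q = B.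
Proof. by move=> /trace_copiesP[ML _] /ML[l _ ->]; rewrite -setIA setIid. Qed.

Lemma trace_systemI (P : finType) k (l : 'I_k -> {set P}) Q :
  trace_system Q [set l i :&: Q | i : 'I_k] =
  trace_system Q [set l i | i : 'I_k].
Proof.
apply: incidence_system_eq => //; apply/seteqP; split=> [_ [B + <-]|_ [B + <-]].
  move=> /imsetP[i _ ->]; exists (l i); first by rewrite /= imset_f.
  by rewrite -setIA setIid.
move=> /imsetP[i _ ->]; exists (l i :&: Q); first by apply/imsetP; exists i.
by rewrite -setIA setIid.
Qed.

(** The map [mk], which pushes a pair forward from the type [points Y] to [T], is a bijection onto
    the subsystems counted. *)
Lemma num_subsystems_trace_copies (U : Type) (X : incidence_system U)
    (T : finType) (Y : incidence_system T) :
  num_subsystems X Y = #|trace_copies X (line_sets Y)|.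
Proof.
set D := trace_copies _ _.
pose mk (QM : {set points Y} * {set {set points Y}}) : incidence_system T :=
  image_system val (trace_system QM.1 QM.2).
have isomk QM : isomorphic (trace_system QM.1 QM.2) (mk QM).
  by apply: isomorphic_image; apply: val_inj.
have setmk : [set S | subsystem S Y /\ isomorphic X S]%classic =
             (mk @` [set` D])%classic.
  apply/seteqP; split=> [S [[SY linesS] iS]|_ [[Q M] QMD <-]].
    pose Q := point_set Y (points S).
    pose M := [set B : {set points Y} |
                `[< exists2 l, lines S l & B = point_set Y l >] ].
    have mkE : mk (Q, M) = S.
      apply: incidence_system_eq; first exact: image_point_set.
      have traceE l : lines S l -> point_set Y l :&: Q = point_set Y l.
        move=> Sl; apply/setIidPl/subsetP => x /in_point_set lx.
        exact/in_point_set/(lines_sub Sl lx).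
      have imE l : lines S l -> (val @` [set` point_set Y l])%classic = l.
        by move=> Sl; apply: image_point_set => x /(lines_sub Sl) /SY.
      apply/seteqP; split=> [_ [_ [B /= BM <-] <-]|l Sl].
        by move: BM; rewrite inE => /asboolP[l Sl ->]; rewrite traceE // imE.
      exists [set` point_set Y l]%classic; last exact: imE.
      exists (point_set Y l); last by rewrite /= traceE.
      by rewrite /= inE; apply/asboolP; exists l.
    exists (Q, M) => //=; apply/trace_copiesP; split.
      move=> B; rewrite inE => /asboolP[l Sl ->].
      have [m Ym ->] := linesS l Sl.
      exists (point_set Y m); first by apply/line_setsP; exists m.
      by apply/setP => x; rewrite !inE classical_sets.in_setI.
    apply: isomorphic_trans iS _; rewrite -{1}mkE.
    exact: isomorphic_sym (isomk (Q, M)).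
  have /trace_copiesP[ML iM] := QMD.
  split; last exact: isomorphic_trans iM (isomk (Q, M)).
  split=> [_ [x _ <-]|_ [_ [B BM <-] <-]] /=; first exact: set_valP.
  have [l' lL BE] := ML B BM; have /line_setsP[l Yl lE] := lL.
  exists l => //; rewrite BE lE -setIA setIid.
  apply/seteqP; split=> [_ [x + <-]|y [ly [x Qx xE]]] /=.
    by move=> /setIP[/in_point_set lx xQ]; split => //; exists x.
  exists x => //; apply/setIP; split=> //; apply/in_point_set.
  by move: ly; rewrite -xE.
rewrite /num_subsystems setmk; apply: card_fset_set.
apply: card_eq_trans (card_eq_finset D); apply: inj_card_eq.
move=> [Q M] [Q' M'] /set_mem QMD /set_mem QMD' mkE.
have QQ' : Q = Q'.
  apply: set_finset_inj; apply: (image_set_inj (@val_inj _ _ (points Y))).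
  exact: (congr1 (@points T) mkE).
rewrite -QQ' in QMD' mkE *; congr (_, _).
(* Members of [N] and [N'] lie inside [Q], so intersecting with [Q] loses nothing and the lines
   determine the set. *)
have sub N N' : (Q, N) \in D -> (Q, N') \in D -> lines (mk (Q, N)) =
    lines (mk (Q, N')) -> N \subset N'.
  move=> QND QND' NN'; apply/subsetP => B BN.
  have : lines (mk (Q, N)) (val @` [set` B])%classic.
    exists [set` B]%classic => //; exists B => //.
    by rewrite (trace_copies_sub QND BN).
  rewrite NN' => -[_ [B' B'N <-]].
  move=> /(image_set_inj (@val_inj _ _ (points Y)))/set_finset_inj.
  by rewrite (trace_copies_sub QND' B'N) => <-.
have lE := congr1 (@lines T) mkE.
by apply/eqP; rewrite eqEsubset !sub.
Qed.

Variables (U : Type) (X : incidence_system U) (k : nat).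
Hypotheses (X_pls : partial_linear_space X) (X_card : (lines X #= `I_k)%card).

Variables (p : nat) (P : finType) (L : {set {set P}}).
Hypothesis pl : fin_plane p L.

Lemma card_trace_lines Q (M : {set {set P}}) :
  (Q, M) \in trace_copies X L -> #|M| = k.
Proof.
move=> QMD; have /trace_copiesP[_ iM] := QMD; apply: card_finset_eq.
apply: card_eq_trans X_card; rewrite (card_eqr (isomorphic_card_lines iM)).
rewrite card_eq_sym.
apply: card_eq_trans (_ :
  ((fun B : {set P} => [set` B :&: Q]) @` [set` M])%classic #= _)%card _.
  by apply: card_eqxx.
apply: inj_card_eq => B B' /set_mem BM /set_mem BM' /set_finset_inj.
by rewrite !(trace_copies_sub QMD).
Qed.

(** Distinct lines share one point, whereas the common trace, a line of a copy of [X], has at least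
    two. *)
Lemma trace_line_unique Q (M : {set {set P}}) l m :
  (Q, M) \in trace_copies X L ->
  l \in L -> m \in L -> l :&: Q \in M -> l :&: Q = m :&: Q -> l = m.
Proof.
move=> QMD lL mL lM lm; have /trace_copiesP[_ iM] := QMD.
have [|x [y [xl yl xy]]] := isomorphic_line_card2 iM X_pls
    (l := [set` l :&: Q]%classic).
  by exists (l :&: Q) => //; rewrite -setIA setIid.
apply/eqP; apply: contraT => /(fp_meet pl lL mL)/eqP/cards1P[z lmz].
have in_z t : t \in l :&: Q -> t = z.
  move=> tl; apply/set1P; rewrite -lmz inE.
  by have := tl; rewrite lm inE => /andP[->];
    move: tl; rewrite inE => /andP[->].
by case: xy; rewrite (in_z x) // (in_z y).
Qed.

(** Each member of [M] is the trace of exactly one line, so these lines form a [k]-element set [A]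
    and the tuples are its orderings. *)
Lemma card_line_tuples_trace Q (M : {set {set P}}) :
  (Q, M) \in trace_copies X L ->
  #|[set l : {ffun 'I_k -> {set P}} |
      is_line_tuple L l && ([set l i :&: Q | i : 'I_k] == M)]| = k`!.
Proof.
move=> QMD; pose A := [set l in L | l :&: Q \in M].
have AE : [set l :&: Q | l in A] = M.
  apply/setP => B; apply/imsetP/idP => [[l + ->]|BM].
    by rewrite inE => /andP[].
  have /trace_copiesP[/(_ B BM)[l lL BE] _] := QMD.
  by exists l => //; rewrite inE lL -BE.
have injA : {in A &, injective (fun l => l :&: Q)}.
  move=> l m; rewrite !inE => /andP[lL lM] /andP[mL _].
  exact: trace_line_unique QMD lL mL lM.
have cA : #|A| = k by rewrite -(card_in_imset injA) AE (card_trace_lines QMD).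
rewrite -[k in k`!]cA -ffactnn [X in _ ^_ X]cA -[X in _ ^_ X]card_ord.
rewrite -card_inj_ffuns_on; apply: eq_card => l; rewrite !inE.
apply/andP/andP => [[/is_line_tupleP[injl lL] /eqP lM]|
                   [/ffun_onP lA /injectiveP injl]].
  split; last exact/injectiveP.
  by apply/ffun_onP => i; rewrite inE lL -lM; apply/imsetP; exists i.
split.
  by apply/is_line_tupleP; split=> // i; have := lA i; rewrite inE => /andP[].
rewrite -AE; apply/eqP; rewrite -(_ : [set l i | i : 'I_k] = A).
  by apply/setP => B; rewrite -imset_comp.
apply/eqP; rewrite eqEcard card_imset // cA card_ord leqnn andbT.
by apply/subsetP => _ /imsetP[i _ ->].
Qed.

(** Double count the pairs of a line tuple and a copy whose lines are the traces of the tuple; given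
    the tuple, [Q] determines the copy. *)
Lemma sum_trace_count :
  \sum_(l : {ffun 'I_k -> {set P}} | is_line_tuple L l) trace_count X l =
  #|trace_copies X L| * k`!.
Proof.
pose tr (l : {ffun 'I_k -> {set P}}) (Q : {set P}) :=
  [set l i :&: Q | i : 'I_k].
transitivity (\sum_(l : {ffun 'I_k -> {set P}} | is_line_tuple L l)
    \sum_(QM in trace_copies X L | tr l QM.1 == QM.2) 1).
  apply: eq_bigr => l /is_line_tupleP[_ lL]; rewrite sum1_card /trace_count.
  rewrite -(card_imset _ (_ : injective (fun Q => (Q, tr l Q)))); last first.
    by move=> ? ? [].
  apply: eq_card => -[Q M]; apply/imsetP/andP => [[Q' + [-> ->]]|].
    rewrite inE => /asboolP iQ; split; last by rewrite /= eqxx.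
    apply/trace_copiesP; split; last by rewrite trace_systemI.
    by move=> _ /imsetP[i _ ->]; exists (l i).
  move=> [/trace_copiesP[_ iM] /eqP /= lM]; exists Q; last by rewrite lM.
  by rewrite inE; apply/asboolP; rewrite -trace_systemI -/(tr l Q) lM.
rewrite (exchange_big_dep (mem (trace_copies X L))) /=; last first.
  by move=> ? ? _ /andP[].
rewrite -sum_nat_const; apply: eq_bigr => -[Q M] QMD.
rewrite -(card_line_tuples_trace QMD) -sum1_card; apply: eq_bigl => l.
by rewrite inE QMD.
Qed.

End Counting.

(** * Invariance under the type of a word *)
Section TypeInvariance.

Variables (U : Type) (X : incidence_system U) (p k : nat).

Definition digit_sets (P : finType) (w : {ffun P -> 'F_p}) :
    {ffun 'I_k -> {set P}} :=
  [ffun i : 'I_k => [set x | odd (lift_word w x %/ 2 ^ i)%N]].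

(** No plane or code enters here. The value 0 discards the words that do not come from line
    tuples. *)
Definition copies_of_word (P : finType) (w : {ffun P -> 'F_p}) : nat :=
  if profile p k (lift_word w) then trace_count X (digit_sets w) else 0.

Lemma trace_count_preim (P P' : finType) (s : P -> P') (l : 'I_k -> {set P'}) :
  bijective s -> trace_count X (fun i => s @^-1: l i) = trace_count X l.
Proof.
move=> bs; have injs := bij_inj bs; have [s' sK s'K] := bs.
rewrite /trace_count -(card_imset _ (imset_inj injs)); apply: eq_card => Q'.
have iso (Q : {set P}) :
    isomorphic X (trace_system Q [set s @^-1: l i | i : 'I_k]) <->
    isomorphic X (trace_system (s @: Q) [set l i | i : 'I_k]).
  have -> : trace_system (s @: Q) [set l i | i : 'I_k] =
            image_system s (trace_system Q [set s @^-1: l i | i : 'I_k]).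
    have imE (B : {set P'}) : [set` B :&: s @: Q]%classic =
        (s @` [set` (s @^-1: B) :&: Q])%classic.
      apply/seteqP; split=> [y /setIP[yB /imsetP[x xQ xE]]|_ [x + <-]].
        by exists x => //; apply/setIP; split; rewrite // inE -xE.
      by move=> /setIP[]; rewrite inE => xB xQ; apply/setIP;
        split; rewrite ?imset_f.
    apply: incidence_system_eq => /=.
      apply/seteqP; split=> [_ /imsetP[x xQ ->]|_ [x xQ <-]].
        by exists x.
      exact: imset_f.
    apply/seteqP; split=> [_ [_ /imsetP[i _ ->] <-]|
                              _ [_ [_ /imsetP[i _ ->] <-] <-]].
      rewrite imE; exists [set` (s @^-1: l i) :&: Q]%classic => //.
      by exists (s @^-1: l i) => //; apply/imsetP; exists i.
    by exists (l i); rewrite ?imE //; apply/imsetP; exists i.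
  have isoQ := isomorphic_image
    (trace_system Q [set s @^-1: l i | i : 'I_k]) injs.
  split=> [iX|iX]; first exact: isomorphic_trans iX isoQ.
  exact: isomorphic_trans iX (isomorphic_sym isoQ).
apply/imsetP/idP => [[Q + ->]|]; first by rewrite !inE => /asboolP/iso/asboolP.
have Q'E : Q' = s @: (s @^-1: Q').
  apply/setP => y; apply/idP/imsetP => [yQ|[x + ->]]; last by rewrite inE.
  by exists (s' y); rewrite ?inE s'K.
move=> Q'X; exists (s @^-1: Q') => //; rewrite inE; apply/asboolP/iso.
by rewrite -Q'E; move: Q'X; rewrite inE => /asboolP.
Qed.

(** [profile] depends only on how often each value occurs, and relabelling points carries traces to
    isomorphic traces. *)
Lemma copies_of_word_comp (P P' : finType) (s : P -> P')
    (w : {ffun P' -> 'F_p}) :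
  bijective s -> copies_of_word [ffun x => w (s x)] = copies_of_word w.
Proof.
move=> bs; rewrite /copies_of_word.
have liftE x : lift_word [ffun x => w (s x)] x = lift_word w (s x).
  by rewrite /lift_word ffunE.
have cE (a : pred nat) :
    #|[set x | a (lift_word [ffun x => w (s x)] x)]| =
    #|[set x | a (lift_word w x)]|.
  rewrite -(on_card_preimset (onW_bij _ bs)); apply: eq_card => x.
  by rewrite !inE liftE.
have -> : profile p k (lift_word [ffun x => w (s x)]) =
          profile p k (lift_word w).
  rewrite /profile (cE (fun n => 0 < n)%N); congr [&& _, _ & _].
    rewrite (eq_bigr _ (fun x _ => liftE x)); congr (_ == _).
    by rewrite [RHS](reindex s) //; apply: onW_bij.
  by apply: eq_forallb => i; rewrite (cE (fun n => n == 2 ^ i)%N).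
case: ifP => // _; rewrite -(trace_count_preim _ bs); congr trace_count.
by apply/funext => i; apply/setP => x; rewrite !ffunE !inE liftE.
Qed.

Lemma word_type_comp (P P' : finType) (s : P -> P')
    (w : {ffun P' -> 'F_p}) :
  bijective s -> word_type [ffun x => w (s x)] = word_type w.
Proof.
move=> bs; apply/mnmP => i; rewrite [LHS]mnmE [RHS]mnmE.
rewrite -[LHS]cardsE -[RHS]cardsE -(on_card_preimset (onW_bij _ bs)).
by apply: eq_card => x; rewrite !inE ffunE.
Qed.

(** Equal types say that the two sequences of values are permutations of each other. *)
Lemma word_type_inj n (v w : {ffun 'I_n -> 'F_p}) : word_type v = word_type w ->
  exists s : {perm 'I_n}, v = [ffun i => w (s i)].
Proof.
move=> vw.
have cE a : #|[pred i | v i == a]| = #|[pred i | w i == a]|.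
  have := congr1 (fun m : 'X_{1..#|'F_p|} => m (enum_rank a)) vw.
  by rewrite /= !mnmE enum_rankK.
have count_cE (u : {ffun 'I_n -> 'F_p}) a :
    count_mem a [tuple u i | i < n] = #|[pred i | u i == a]|.
  by rewrite count_map cardE /enum_mem size_filter -enumT val_ord_tuple.
have /tuple_permP[s sE] : perm_eq [tuple v i | i < n] [tuple w i | i < n].
  by apply/allP => a _; rewrite /= !count_cE cE.
exists s; apply/ffunP => i; rewrite ffunE.
have := congr1 (fun t => nth 0 t i) sE.
by rewrite -!tnth_nth !tnth_mktuple.
Qed.

Lemma mdeg_word_type (P : finType) (w : {ffun P -> 'F_p}) :
  mdeg (word_type w) = #|P|.
Proof.
rewrite mdegE -[RHS]sum1_card [RHS](partition_big w predT) //=.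
rewrite [RHS](reindex (fun i : 'I_#|'F_p| => enum_val i)); last first.
  exact/onW_bij/enum_val_bij.
by apply: eq_bigr => i _; rewrite mnmE sum1_card.
Qed.

(** Evaluated on an arbitrary word of type [j] over ['I_n], hence independent of any plane. The
    factor [k!] compensates for the orderings of the lines of a copy. *)
Definition copies_coef n (j : 'X_{1..#|'F_p|}) : rat :=
  if [pick v : {ffun 'I_n -> 'F_p} | word_type v == j] is Some v
  then (copies_of_word v)%:R / k`!%:R else 0.

Lemma copies_coefE (P : finType) (w : {ffun P -> 'F_p}) :
  copies_coef #|P| (word_type w) = (copies_of_word w)%:R / k`!%:R.
Proof.
have bs : bijective (@enum_val P predT) by apply: enum_val_bij.
rewrite /copies_coef; case: pickP => [v /eqP vw|].
  have [s ->] : exists s : {perm 'I_#|P|},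
      v = [ffun i => [ffun j => w (enum_val j)] (s i)].
    by apply: word_type_inj; rewrite vw word_type_comp.
  rewrite copies_of_word_comp ?copies_of_word_comp //.
  by exists (s^-1)%g; [apply: permK | apply: permKV].
move=> /(_ [ffun i => w (enum_val i)]).
by rewrite word_type_comp // eqxx.
Qed.

End TypeInvariance.

(** * Summation over the words of the code *)

Section WordSum.

Variables (U : Type) (X : incidence_system U) (p k : nat).
Hypotheses (p_prime : prime p) (kp : (2 ^ k <= p)%N).

Lemma digit_sets_tuple_word (P : finType) (l : {ffun 'I_k -> {set P}}) :
  digit_sets k (tuple_word p l) = l.
Proof.
apply/ffunP => i; apply/setP => x.
by rewrite ffunE inE lift_tuple_word // odd_sum_digits.
Qed.

Lemma lift_tuple_word_fun (P : finType) (l : {ffun 'I_k -> {set P}}) :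
  lift_word (tuple_word p l) = (fun x => \sum_(i < k) 2 ^ i * (x \in l i))%N.
Proof. by apply/funext => x; rewrite lift_tuple_word. Qed.

Variables (T : finType) (Y : incidence_system T).
Hypotheses (planeY : projective_plane Y) (orderY : has_order Y p).

(** [tuple_word] and [digit_sets] are mutually inverse between line tuples and code words satisfying
    [profile]; all other words contribute 0. *)
Lemma sum_copies_of_word :
  (\sum_(w : {ffun points Y -> 'F_p} | w \in code p Y) copies_of_word X k w =
   \sum_(l : {ffun 'I_k -> {set points Y}} | is_line_tuple (line_sets Y) l)
     trace_count X l)%N.
Proof.
have pl := projective_plane_fin_plane planeY orderY.
rewrite -big_mkcondr /=.
rewrite (reindex_onto (@tuple_word p _ k) (@digit_sets p k _)) /=; last first.
  move=> w /andP[wC profw].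
  by have [l _ ->] := code_profile p_prime planeY orderY kp wC profw;
    rewrite digit_sets_tuple_word.
apply: eq_big => [l|l _]; last by rewrite digit_sets_tuple_word.
rewrite digit_sets_tuple_word eqxx andbT.
apply/andP/idP => [[lC profl]|lL].
  have [l' l'L /(congr1 (@digit_sets p k _))] :=
    code_profile p_prime planeY orderY kp lC profl.
  by rewrite !digit_sets_tuple_word => ->.
split; first exact: tuple_word_code.
by rewrite lift_tuple_word_fun; apply: (line_tuple_profile pl).
Qed.

End WordSum.

Theorem theorem4p2 (p : nat) (p_prime : prime p)
    (U : Type) (X : incidence_system U)
    (X_pls : partial_linear_space X)
    (X_lines : (lines X #<= `I_(trunc_log 2 p))%classic%card) :
  exists alpha : 'X_{1..#|'F_p|} -> rat,
    forall (T : finType) (pi : incidence_system T),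
      projective_plane pi -> has_order pi p ->
      let f := complete_weight_enumerator (code p pi) in
      (num_subsystems X pi)%:R =
        \sum_(j : 'X_{1..#|'F_p| < (p ^ 2 + p + 1).+1}
               | mdeg j == (p ^ 2 + p + 1)%N) alpha j * f@_j.
Proof.
have [k X_card] : exists k, (lines X #= `I_k)%classic%card.
  by apply/finite_setP/finite_set_leP; exists (trunc_log 2 p).
have kp : (2 ^ k <= p)%N.
  have := X_lines; rewrite (card_le_eql X_card) card_le_II => kp.
  apply: leq_trans (trunc_logP (isT : (1 < 2)%N) (prime_gt0 p_prime)).
  by rewrite leq_exp2l.
exists (copies_coef X k (p ^ 2 + p + 1)) => T pi plane_pi order_pi f.
have pl := projective_plane_fin_plane plane_pi order_pi.
have card_points : #|{: points pi}| = (p ^ 2 + p + 1)%N.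
  have [[x px] _ _ _] := plane_pi.
  exact: card_fin_plane (SigSub (mem_set px)) pl.
have kfact : (k`!%:R : rat) != 0 by rewrite Num.Theory.pnatr_eq0 -lt0n fact_gt0.
(* After multiplication by [k!] both sides count line tuples weighted by [trace_count]. *)
have -> : (num_subsystems X pi)%:R =
    \sum_(w : {ffun points pi -> 'F_p} | w \in code p pi)
      copies_coef X k (p ^ 2 + p + 1) (word_type w).
  apply: (mulIf kfact); rewrite num_subsystems_trace_copies -natrM.
  rewrite -(sum_trace_count X_pls X_card pl).
  rewrite -(sum_copies_of_word X p_prime kp plane_pi order_pi).
  rewrite natr_sum mulr_suml.
  by apply: eq_bigr => w _; rewrite -card_points copies_coefE mulfVK.
have fE j : f@_j = \sum_(w : {ffun points pi -> 'F_p} | w \in code p pi)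
                     (word_type w == j)%:R.
  rewrite /f /complete_weight_enumerator raddf_sum.
  by apply: eq_bigr => w _; rewrite /= mcoeffX.
under [RHS]eq_bigr do rewrite fE mulr_sumr.
(* For each word only the index [j = word_type w] survives, and it is in range because its degree is
   the number of points. *)
rewrite exchange_big /=; apply: eq_bigr => w _.
have wdeg : mdeg (word_type w) = (p ^ 2 + p + 1)%N by rewrite mdeg_word_type.
have wlt : (mdeg (word_type w) < (p ^ 2 + p + 1).+1)%N by rewrite wdeg.
rewrite (bigD1 (BMultinom wlt)) /= ?wdeg // eqxx mulr1 big1 ?addr0 // => j.
move=> /andP[_ jw]; case: eqP => [E|]; last by rewrite mulr0.
by case/eqP: jw; apply: val_inj.
Qed.
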